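(* Let $\kappa$ be an uncountable cardinal with $\kappa=\kappa^{<\kappa}$. Assume that $\kappa$ is not weakly compact and that all closed subsets of ${}^\kappa\kappa$ have the $\kappa$-perfect set property. Then for every $A\subseteq{}^\kappa\kappa$ the following are equivalent: (a) $A$ is a $\mathrm{K}_\kappa$ subset of ${}^\kappa\kappa$; (b) $A$ is contained in a $\mathrm{K}_\kappa$ subset of ${}^\kappa\kappa$; (c) $A$ has cardinality at most $\kappa$.
   Context: ${}^\kappa\kappa$ is the set of all functions from $\kappa$ to $\kappa$ with the bounded topology, whose basic open sets are $N_s=\{x\in{}^\kappa\kappa \mid s\subseteq x\}$ for $s\in{}^{<\kappa}\kappa$ (functions from an ordinal ${<}\kappa$ into $\kappa$); ${}^\kappa 2$ carries the subspace topology. $A\subseteq{}^\kappa\kappa$ is $\kappa$-compact if every open cover of $A$ has a subcover of size less than $\kappa$, and $\mathrm{K}_\kappa$ if it is a union of $\kappa$-many (i.e. at most $\kappa$-many) $\kappa$-compact subsets of ${}^\kappa\kappa$. $A$ has the $\kappa$-perfect set property if either $A$ has cardinality at most $\kappa$, or else $A$ contains a closed subset of ${}^\kappa\kappa$ homeomorphic to ${}^\kappa 2$. *)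

(* Defs.v *)
From HB Require Import structures.
From mathcomp Require Import all_boot all_order.
From mathcomp Require Import all_classical.
From mathcomp Require Import topology.

Set Implicit Arguments.
Unset Strict Implicit.
Unset Printing Implicit Defensive.

Import Order.TTheory.
Local Open Scope classical_set_scope.
Local Open Scope order_scope.
Local Open Scope card_scope.

Definition card_lt {T U : Type} (A : set T) (B : set U) : Prop :=
  A #<= B /\ ~ (B #<= A).

(* A nonzero ordinal is represented by a well-ordered type K, each ordinal
   below it being the order type of the elements below some a : K; its least
   element is \bot.  It is a cardinal when it is an initial ordinal. *)
Definition is_initial_ordinal {d} (K : bOrderType d) : Prop :=
  well_founded (fun a b : K => a < b) /\
  forall a : K, card_lt [set b : K | b < a] [set: K].

(* kappa -> (kappa)^2_2 for an uncountable kappa; a colouring of the unordered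
   pairs is given by its values c a b for a < b. *)
Definition weakly_compact {d} (K : bOrderType d) : Prop :=
  ~ countable [set: K] /\
  forall c : K -> K -> bool, exists H : set K, H #= [set: K] /\
    exists i : bool, forall a b, H a -> H b -> a < b -> c a b = i.

Definition gbaire {d} (K : bOrderType d) : Type := K -> K.

(* The functions from an ordinal below kappa to kappa. *)
Definition lt_kappa_seq {d} (K : bOrderType d) : Type :=
  {a : K & {b : K | b < a} -> K}.

Definition basic_open {d} {K : bOrderType d} (s : lt_kappa_seq K) : set (gbaire K) :=
  [set x | forall i : {b : K | b < projT1 s}, x (proj1_sig i) = projT2 s i].

Section BoundedTopology.
Context {d : Order.disp_t} {K : bOrderType d}.

Definition restrict_below (x : gbaire K) (a : K) : lt_kappa_seq K :=
  existT (fun a => {b : K | b < a} -> K) a (fun i => x (proj1_sig i)).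

HB.instance Definition _ := gen_eqMixin (gbaire K).
HB.instance Definition _ := gen_choiceMixin (gbaire K).
HB.instance Definition _ := gen_eqMixin (lt_kappa_seq K).
HB.instance Definition _ := gen_choiceMixin (lt_kappa_seq K).
HB.instance Definition _ := isPointed.Build (lt_kappa_seq K) (restrict_below id \bot).

Lemma basic_open_cover : \bigcup_(s in [set: lt_kappa_seq K]) basic_open s = setT.
Proof. by apply/seteqP; split=> // x _; exists (restrict_below x \bot). Qed.

Lemma basic_open_join (s t : lt_kappa_seq K) (x : gbaire K) :
  [set: lt_kappa_seq K] s -> [set: lt_kappa_seq K] t -> basic_open s x -> basic_open t x ->
  exists u, [/\ [set: lt_kappa_seq K] u, basic_open u x &
                basic_open u `<=` basic_open s `&` basic_open t].
Proof.
move=> _ _ sx tx; exists (restrict_below x (Order.max (projT1 s) (projT1 t))).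
split=> // y xy; split=> i.
- have lti : proj1_sig i < Order.max (projT1 s) (projT1 t).
    by rewrite lt_max (proj2_sig i).
  by rewrite -sx; exact: (xy (exist _ (proj1_sig i) lti)).
- have lti : proj1_sig i < Order.max (projT1 s) (projT1 t).
    by rewrite lt_max (proj2_sig i) orbT.
  by rewrite -tx; exact: (xy (exist _ (proj1_sig i) lti)).
Qed.

HB.instance Definition _ :=
  isBaseTopological.Build (gbaire K) basic_open_cover basic_open_join.

End BoundedTopology.

(* ^kappa 2 as a subset of ^kappa kappa: the ordinals below 2 are those with at
   most one predecessor. *)
Definition gcantor {d} (K : bOrderType d) : set (gbaire K) :=
  [set x | forall i : K, is_subset1 [set b : K | b < x i]].
Arguments gcantor {d} K _.

Definition homeomorphic {d} {K : bOrderType d} (A B : set (gbaire K)) : Prop :=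
  exists f g : gbaire K -> gbaire K,
    [/\ set_fun A B f, set_fun B A g,
        {in A, cancel f g} & {in B, cancel g f}] /\
    {within A, continuous f} /\ {within B, continuous g}.

Definition kappa_compact {d} {K : bOrderType d} (A : set (gbaire K)) : Prop :=
  forall F : set (set (gbaire K)),
    (forall U, F U -> open U) -> A `<=` \bigcup_(U in F) U ->
    exists G : set (set (gbaire K)),
      [/\ G `<=` F, card_lt G [set: K] & A `<=` \bigcup_(U in G) U].

Definition K_kappa {d} {K : bOrderType d} (A : set (gbaire K)) : Prop :=
  exists F : set (set (gbaire K)),
    [/\ F #<= [set: K], forall B, F B -> kappa_compact B &
        A = \bigcup_(B in F) B].

Definition kappa_psp {d} {K : bOrderType d} (A : set (gbaire K)) : Prop :=
  A #<= [set: K] \/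
  exists C : set (gbaire K),
    [/\ closed C, C `<=` A & homeomorphic C (gcantor K)].

(* Main.v *)
Require Import Defs.
From mathcomp Require Import all_boot all_order.
From mathcomp Require Import all_classical.
From mathcomp Require Import topology.

(* Koenig's theorem makes kappa regular. Hence kappa-compact sets are closed, and
   by the perfect set property a kappa-compact set of size > kappa contains a
   closed, thus kappa-compact, copy of ^kappa 2. But kappa-compactness of
   ^kappa 2 gives kappa -> (kappa)^2_2: for a colouring c, let y_b(i) = c(i, b)
   for i < b and 0 elsewhere. Compactness yields a branch x each of whose initial
   segments is shared by unboundedly many y_b. The greedy set H of those b with
   c(i, b) = x(i) for all i < b in H is then unbounded, and c(i, b) depends only
   on i for i < b in H, so one of the two colour classes of H is homogeneous of
   size kappa. *)

Import Order.TTheory.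
Local Open Scope order_scope.
Local Open Scope classical_set_scope.
Local Open Scope card_scope.

Lemma card_le_of_inj {T U} (f : T -> U) (A : set T) (B : set U) :
  set_fun A B f -> set_inj A f -> A #<= B.
Proof.
move=> fAB finj; have [g] : $|{injfun A >-> B}| by apply/injfunPex; exists f.
exact: inj_card_le.
Qed.

Lemma inj_of_card_le {T U} (u0 : U) (A : set T) (B : set U) :
  A #<= B -> exists2 f : T -> U, set_fun A B f & set_inj A f.
Proof.
elim/Ppointed: U => U in u0 B *; first by case: (no u0).
by move=> /pcard_leP/injfunPex.
Qed.

Lemma countable_not_le {T U} {A : set T} {B : set U} :
  countable A -> ~ countable B -> ~ (B #<= A).
Proof. by move=> cA ncB BA; apply/ncB/(card_le_trans BA). Qed.

(** * Recursion, minima and greedy enumeration along a well-order *)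

Section WellOrder.
Set Implicit Arguments.
Context {d : Order.disp_t} {K : bOrderType d}.
Context (wfK : well_founded (fun a b : K => a < b)).

Lemma wf_recursion (T : Type) (t0 : T) (Phi : (K -> T) -> K -> T) :
  (forall f g a, (forall b, b < a -> f b = g b) -> Phi f a = Phi g a) ->
  exists f, forall a, f a = Phi f a.
Proof.
move=> loc.
(* [Phi] expects a total function, so the values known below [a] are padded with [t0]; by [loc] the
   padding does not affect [Phi] at [a]. *)
pose F a (rec : forall b, b < a -> T) :=
  Phi (fun b => if pselect (b < a) is left h then rec b h else t0) a.
exists (Fix wfK (fun=> T) F) => a; rewrite Fix_eq.
  by apply: loc => b ba; case: pselect.
by move=> x f g fg; apply: loc => b bx; case: pselect.
Qed.

Lemma wf_least (P : set K) :
  P !=set0 -> exists2 a, P a & forall b, P b -> a <= b.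
Proof.
move=> [x]; elim/(well_founded_ind wfK): x => x IH Px.
have [[y Py yx]|no] := pselect (exists2 y, P y & y < x); first exact: (IH y).
by exists x => // b Pb; rewrite leNgt; apply/negP => bx; apply: no; exists b.
Qed.

Lemma not_has_ubound (X : set K) m :
  ~ has_ubound X -> exists2 x, X x & m < x.
Proof.
move=> nX; apply: contrapT => no; apply: nX; exists m => x Xx.
by rewrite leNgt; apply/negP => mx; apply: no; exists x.
Qed.

(* Enumerate [X] greedily along [K]: either the enumeration never stops, or it
   exhausts [X] at some stage [a]. *)
Lemma card_ge_or_segment_image (X : set K) :
  [set: K] #<= X \/ exists a (h : K -> K), X `<=` h @` [set b | b < a].
Proof.
have [|h hE] := wf_recursion \bot (fun h a => xget \bot (X `\` h @` [set b | b < a])).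
  move=> f g a fg; congr (xget _ (_ `\` _)).
  by apply: eq_imagel => b /= /fg.
have [[a no]|ex] := pselect (exists a, ~ (X `\` h @` [set b | b < a] !=set0)).
  right; exists a, h => x Xx; apply: contrapT => nx; apply: no.
  by exists x.
left; have hX a : (X `\` h @` [set b | b < a]) (h a).
  by rewrite [h a]hE; apply: xgetPex; apply: contrapT => no; apply: ex; exists a.
apply: (card_le_of_inj h) => [a _|a b _ _ hab]; first by case: (hX a).
case: (ltgtP a b) => // ltab.
  by case: (hX b) => _ []; exists a.
by case: (hX a) => _ []; exists b.
Qed.

End WellOrder.

(** * Regularity and cardinal arithmetic drawn from the bound on [lt_kappa_seq K] *)

Section Konig.
Set Implicit Arguments.
Context {d : Order.disp_t} {K : bOrderType d}.
Context (K_init : is_initial_ordinal K) (K_uncountable : ~ countable [set: K]).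
Context (K_power : [set: lt_kappa_seq K] #<= [set: K]).

Lemma basic_open_restrictP (x y : gbaire K) (a : K) :
  basic_open (restrict_below x a) y <-> forall i, i < a -> y i = x i.
Proof.
by split=> [xy i ia|xy [i ia]]; [exact: (xy (exist _ i ia))|exact: xy].
Qed.

(* Koenig's diagonal argument: if the sets [D b] with [b < a] were all smaller
   than [K], some function on [a] would differ at [b] from the [e]-th function
   for every [e] in [D b], hence would not be enumerated. *)
Lemma konig_diagonal (a : K) (D : K -> set K) :
  (forall e, exists2 b, b < a & D b e) ->
  exists2 b, b < a & [set: K] #<= D b.
Proof.
move=> Dcov; apply: contrapT => small.
have [g gsurj] : exists g : K -> lt_kappa_seq K, set_surj setT setT g.
  exact/pcard_surjP.
(* [y e] is a total extension of the [e]-th sequence when that sequence has length [a], and the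
   default [id] otherwise. *)
pose y e : gbaire K := xget (id : gbaire K) [set y : gbaire K | restrict_below y a = g e].
pose V b := (y^~ b) @` D b.
pose s b := xget \bot (~` V b).
have sV b : b < a -> ~ V b (s b).
  move=> ba; suff: (~` V b) !=set0 by move=> /(xgetPex \bot).
  apply: contrapT => VT.
  apply: small; exists b => //; apply: (card_le_trans _ (card_image_le (y^~ b) (D b))).
  by apply: subset_card_le => x _; apply: contrapT => nVx; apply: VT; exists x.
have [e _ ge] := gsurj (restrict_below s a) I.
have [b ba Dbe] := Dcov e; apply: (sV b ba); exists e => //.
have yE : restrict_below (y e) a = restrict_below s a.
  by rewrite -ge; exact: (@xgetI (gbaire K) id [set z | restrict_below z a = g e] s (esym ge)).
have /basic_open_restrictP : basic_open (restrict_below s a) (y e).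
  by rewrite -yE; apply/basic_open_restrictP.
exact.
Qed.

(** Regularity of kappa: if the values [h b] were unbounded, the segments below them would cover
    [K], and Koenig's argument would make one of these segments as large as [K], which is an initial
    ordinal. *)
Lemma has_ubound_segment_image (a : K) (h : K -> K) :
  has_ubound (h @` [set b | b < a]).
Proof.
apply: contrapT => nub.
have [e|b _] := @konig_diagonal a (fun b => [set e | e < h b]).
  by have [_ [b ba <-] ehb] := not_has_ubound e nub; exists b.
by case: K_init => _ /(_ (h b))[_].
Qed.

(** The greedy enumeration of such a set stops at a proper stage, so regularity applies. *)
Lemma has_ubound_small (X : set K) : ~ ([set: K] #<= X) -> has_ubound X.
Proof.
move=> KX; have [//|[a [h Xh]]] := card_ge_or_segment_image K_init.1 X.
by have [m hm] := has_ubound_segment_image a h; exists m => x /Xh /hm.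
Qed.

(** If [a] were the greatest element, the pairs of [a] with some [b < a] would cover [K], and
    Koenig's argument would make a two-element set as large as [K]. The pair with [\bot] covers [a]
    itself, whence the need for [\bot < a]. *)
Lemma ex_gt (a : K) : exists b, a < b.
Proof.
apply: contrapT => amax.
have le_a b : b <= a by rewrite leNgt; apply/negP => ab; apply: amax; exists b.
have bot_lt : \bot < a.
  rewrite lt_neqAle le0x andbT; apply/eqP => aE; apply: K_uncountable.
  apply: (@sub_countable _ _ _ [set a]); last exact: countable1.
  by apply: subset_card_le => b _ /=; apply/le_anti; rewrite le_a -aE le0x.
have [e|b _] := @konig_diagonal a (fun b => [set b; a]).
  have [ea|->] : e < a \/ e = a.
    by have:= le_a e; rewrite le_eqVlt => /orP[/eqP|]; [right|left].
  - by exists e => //; left.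
  - by exists \bot => //; right.
by apply: countable_not_le K_uncountable; apply/finite_set_countable/finite_set2.
Qed.

Lemma unbounded_large (X : set K) : ~ has_ubound X -> X #= [set: K].
Proof.
move=> nX; rewrite card_eq_le card_leT /=.
by apply: contrapT => /negP small; apply/nX/has_ubound_small/negP.
Qed.

Lemma card_setX_le : [set: K * K] #<= [set: K].
Proof.
(* A pair is coded as a sequence of length [t], long enough to have the positions [\bot] and [u],
   which hold the two coordinates. *)
have [u bot_u] := ex_gt \bot; have [t ut] := ex_gt u.
apply: card_le_trans K_power.
pose f (p : K * K) := restrict_below (fun i => if i == \bot then p.1 else p.2) t.
apply: (card_le_of_inj f) => // -[x y] [x' y'] _ _ fE.
have : basic_open (f (x', y')) (fun i => if i == \bot then x else y).
  by rewrite -fE; apply/basic_open_restrictP.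
move/basic_open_restrictP => E.
have := E _ (lt_trans bot_u ut); have := E _ ut.
by rewrite /= eqxx gt_eqF // => -> ->.
Qed.

(** A point is coded by a pair: the code of a chosen member of [F] containing it, and its own code
    inside that member. *)
Lemma card_bigcup_le {T : Type} (F : set (set T)) :
  F #<= [set: K] -> (forall B, F B -> B #<= [set: K]) ->
  \bigcup_(B in F) B #<= [set: K].
Proof.
move=> /(inj_of_card_le \bot)[phi _ phi_inj] FK.
have [psi psi_inj] : {psi : set T -> T -> K & forall B, F B -> set_inj B (psi B)}.
  apply: (@choice _ _ (fun B f => F B -> set_inj B f)) => B.
  have [/FK/(inj_of_card_le \bot)[f _ finj]|nFB] := pselect (F B).
    by exists f.
  by exists (fun=> \bot).
have [c cP] : {c : T -> set T &
    forall x, (\bigcup_(B in F) B) x -> F (c x) /\ c x x}.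
  apply: (@choice _ _ (fun x B => (\bigcup_(B in F) B) x -> F B /\ B x)) => x.
  have [[B FB Bx]|nx] := pselect ((\bigcup_(B in F) B) x).
    by exists B.
  by exists set0.
apply: card_le_trans card_setX_le.
apply: (card_le_of_inj (fun x => (phi (c x), psi (c x) x))) => // x y.
rewrite !inE => /cP[Fx xx] /cP[Fy yy] [/phi_inj cxy].
by rewrite cxy ?inE // => /psi_inj; apply; rewrite ?inE // -cxy // inE.
Qed.

End Konig.

(** * Open sets through initial segments; closed subsets and continuous images of kappa-compact
    sets *)

Section Compactness.
Set Implicit Arguments.
Context {d : Order.disp_t} {K : bOrderType d}.

Lemma open_gbaireP (U : set (gbaire K)) :
  open U <-> forall x, U x ->
    exists a, forall y, (forall i, i < a -> y i = x i) -> U y.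
Proof.
split=> [[D _ <-] x [s Ds sx]|nbhd].
  exists (projT1 s) => y yx; exists s => // i.
  by rewrite yx ?(proj2_sig i)// sx.
exists [set s | basic_open s `<=` U] => //; apply/seteqP; split=> [x [s sU]|x Ux].
  exact: sU.
have [a aU] := nbhd _ Ux; exists (restrict_below x a) => [y /basic_open_restrictP|].
  exact: aU.
exact/basic_open_restrictP.
Qed.

Lemma open_basic_open (s : lt_kappa_seq K) : open (basic_open s).
Proof.
apply/open_gbaireP => x sx; exists (projT1 s) => y yx i.
by rewrite yx ?(proj2_sig i)// sx.
Qed.

Lemma kappa_compact_closed_sub (A B : set (gbaire K)) :
  kappa_compact A -> closed B -> B `<=` A -> kappa_compact B.
Proof.
move=> cA clB BA F Fop Fcov.
have [||G [GF [GK KG] Gcov]] := cA (F `|` [set ~` B]).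
- by move=> U [/Fop//|->]; exact: closed_openC.
- move=> x Ax; have [/Fcov[U FU Ux]|nBx] := pselect (B x).
    by exists U => //; left.
  by exists (~` B) => //; right.
exists (G `&` F); split; first exact: subIsetr.
- split; first exact: card_le_trans (subset_card_le (@subIsetl _ _ _)) GK.
  by move=> /card_le_trans /(_ (subset_card_le (@subIsetl _ _ _))).
- move=> x Bx; have [U GU Ux] := Gcov x (BA _ Bx).
  by have [FU|UB] := GF _ GU; [exists U|move: Ux; rewrite UB].
Qed.

Lemma kappa_compact_image (A B : set (gbaire K)) (f : gbaire K -> gbaire K) :
  kappa_compact A -> {within A, continuous f} -> set_fun A B f -> set_surj A B f ->
  kappa_compact B.
Proof.
move=> cA /continuousP fcont fAB fsurj F Fop Fcov.
(* [V] runs over the open sets whose trace on [A] is mapped into some member of [F]; a small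
   subcover by such [V] is then sent back to [F]. *)
pose pull (V : set (gbaire K)) U := F U /\ V `&` A `<=` f @^-1` U.
have [||G [GF [GK KG] Gcov]] := cA [set V | open V /\ exists U, pull V U].
- by move=> V [].
- move=> x Ax; have [U FU Ufx] := Fcov _ (fAB _ Ax).
  have /open_subspaceP[V oV VU] := fcont U (Fop U FU).
  have VUx : (V `&` A) x by rewrite VU.
  exists V; last by case: VUx.
  by split=> //; exists U; split=> //; rewrite VU => y [].
pose u V := xget set0 (pull V).
have uP V : G V -> pull V (u V) by move=> /GF[_ [U VU]]; exact: (xgetI set0 VU).
exists (u @` G); split.
- by move=> _ [V /uP[FV _] <-].
- split; first exact: card_le_trans (card_image_le u G) GK.
  by move=> /card_le_trans /(_ (card_image_le u G)).
- move=> _ /fsurj[x Ax <-]; have [V GV Vx] := Gcov x Ax.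
  by exists (u V); [exists V|case: (uP V GV) => _; apply].
Qed.

End Compactness.

(** * Consequences of kappa-compactness for regular kappa *)

Section RegularCompactness.
Set Implicit Arguments.
Context {d : Order.disp_t} {K : bOrderType d}.
Context (K_init : is_initial_ordinal K) (K_uncountable : ~ countable [set: K]).
Context (K_power : [set: lt_kappa_seq K] #<= [set: K]).

Lemma has_ubound_small_image {T : Type} (G : set T) (r : T -> K) :
  card_lt G [set: K] -> has_ubound (r @` G).
Proof.
move=> [_ KG]; apply: has_ubound_small => //.
by move=> /card_le_trans /(_ (card_image_le r G)).
Qed.

(** For [x] outside [A], the sets [N a] increase with [a] and cover everything but [x]. By
    regularity a small subcover lies inside a single [N m], so the neighbourhood of [x] of length
    [m] misses [A]. *)
Lemma kappa_compact_closed (A : set (gbaire K)) : kappa_compact A -> closed A.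
Proof.
move=> cA; rewrite -[A]setCK; apply: open_closedC; apply/open_gbaireP => x nAx.
pose N a : set (gbaire K) := ~` basic_open (restrict_below x a).
have [||G [GF Gsmall Gcov]] := cA (range N).
- move=> _ [a _ <-]; apply/open_gbaireP => y nxy; exists a => z zy.
  apply: contra_not nxy => /basic_open_restrictP zx.
  by apply/basic_open_restrictP => i ia; rewrite -zy ?zx.
- move=> y Ay; have [i yxi] : exists i, y i <> x i.
    apply: contrapT => no; apply: nAx; suff <- : y = x by [].
    by apply/funext => i; apply: contrapT => yxi; apply: no; exists i.
  have [a ia] := ex_gt K_uncountable K_power i.
  by exists (N a) => //; move/basic_open_restrictP/(_ i ia).
pose r U := xget \bot [set a | U = N a].
have rP U : G U -> U = N (r U).
  by move=> /GF[a _ /esym NU]; exact: (@xgetI _ \bot [set a | U = N a] a).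
have [m mG] := has_ubound_small_image r Gsmall.
exists m => y yx Ay; have [U GU] := Gcov y Ay.
rewrite (rP U GU); apply; apply/basic_open_restrictP => i ir.
by apply: yx; apply: lt_le_trans ir _; apply: mG; exists U.
Qed.

(* If no branch were good, the neighbourhoods [N_s] that contain [y b] for
   boundedly many [b] would cover [gcantor K]; fewer than kappa of them would
   already contain all the [y b]. *)
Lemma kappa_compact_gcantor_branch (y : K -> gbaire K) :
  kappa_compact (gcantor K) -> (forall b, gcantor K (y b)) ->
  exists x : gbaire K, forall a m, exists2 b, m < b & forall i, i < a -> y b i = x i.
Proof.
move=> cC yC; apply: contrapT => no.
pose bdd (s : lt_kappa_seq K) := [set b | basic_open s (y b)].
have [||G [GF Gsmall Gcov]] := cC (@basic_open _ K @` [set s | has_ubound (bdd s)]).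
- by move=> _ [s _ <-]; exact: open_basic_open.
- move=> x _; apply: contrapT => nx; apply: no; exists x => a m.
  apply: contrapT => nb; apply: nx.
  exists (basic_open (restrict_below x a)); last exact/basic_open_restrictP.
  exists (restrict_below x a) => //; exists m => b /basic_open_restrictP yx.
  by rewrite leNgt; apply/negP => mb; apply: nb; exists b.
pose bound U := xget \bot (ubound [set b | U (y b)]).
have boundP U : G U -> ubound [set b | U (y b)] (bound U).
  by move=> /GF[s [m sm] <-]; exact: (xgetI \bot sm).
have [m mG] := has_ubound_small_image bound Gsmall.
have [b mb] := ex_gt K_uncountable K_power m.
have [U GU Uyb] := Gcov _ (yC b).
have bm : b <= m by apply: le_trans (boundP U GU b Uyb) _; apply: mG; exists U.
by move: mb; rewrite ltNge bm.
Qed.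

Lemma gcantor_two_values :
  exists2 one : K, \bot < one & forall x : gbaire K,
    (forall i, x i = \bot \/ x i = one) -> gcantor K x.
Proof.
(* The least element above [\bot] is the ordinal 1: its only predecessor is [\bot]. *)
have [one one_gt0 one_min] := wf_least K_init.1 (ex_gt K_uncountable K_power \bot).
exists one => // x x01 i b c /=; case: (x01 i) => ->; first by rewrite ltx0.
have lt1 e : e < one -> e = \bot.
  move=> e1; case: (eqVneq e \bot) => // e0.
  by move: e1; rewrite ltNge one_min //= lt0x.
by move=> /lt1-> /lt1->.
Qed.

Lemma kappa_compact_gcantor_weakly_compact :
  kappa_compact (gcantor K) -> weakly_compact K.
Proof.
move=> cC; split=> // c.
have [one one_gt0 gcantor01] := gcantor_two_values.
pose y b : gbaire K := fun i => if (i < b) && c i b then one else \bot.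
have [|x xP] := @kappa_compact_gcantor_branch y cC.
  by move=> b; apply: gcantor01 => i; rewrite /y; case: ifP; [right|left].
(* The bit [x i != \bot] reads off the colour [c i b], but only for [i < b], since [y b] is [\bot]
   from [b] on. *)
have cx a m : exists2 b, m < b & forall i, i < a -> i < b -> c i b = (x i != \bot).
  have [b mb bx] := xP a m; exists b => // i ia ib.
  by rewrite -bx // /y ib /=; case: (c i b); rewrite ?eqxx // gt_eqF.
have [H HE] : exists H : K -> Prop,
    forall b, H b = forall i, H i -> i < b -> c i b = (x i != \bot).
  apply: (wf_recursion K_init.1 True
    (fun H b => forall i, H i -> i < b -> c i b = (x i != \bot))) => f g b fg.
  by apply/propext; split=> E i + ib; [rewrite -fg//|rewrite fg//] => /E; apply.
(* If [m] bounded [H], some [b > m] with [y b] following [x] past [m] would satisfy every condition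
   for joining [H]. *)
have nH : ~ has_ubound H.
  move=> [m mH]; have [a ma] := ex_gt K_uncountable K_power m.
  have [b mb bc] := cx a m.
  have : H b by rewrite HE => i Hi; apply: bc; apply: le_lt_trans ma; exact: mH.
  by move=> /mH; rewrite leNgt mb.
pose H_ (t : bool) : set K := [set b | H b /\ (x b != \bot) = t].
have [t nHt] : exists t, ~ has_ubound (H_ t).
  apply: contrapT => no; apply: nH.
  have bd t : has_ubound (H_ t) by apply: contrapT => nt; apply: no; exists t.
  have [[m mP] [n nP]] := (bd true, bd false).
  exists (Order.max m n) => b Hb; rewrite le_max.
  by case E: (x b != \bot); [rewrite mP|rewrite nP ?orbT].
exists (H_ t); split; first exact: unbounded_large.
by exists t => a b [Ha <-] [Hb _] ab; move: Hb; rewrite HE; apply.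
Qed.

Lemma kappa_compact_card_le (A : set (gbaire K)) :
  ~ weakly_compact K -> (forall C : set (gbaire K), closed C -> kappa_psp C) ->
  kappa_compact A -> A #<= [set: K].
Proof.
move=> nwc psp cA; have [//|[C [clC CA]]] := psp A (kappa_compact_closed cA).
move=> [f [g [[fC gC _ gK] [fcont _]]]]; case: nwc.
apply: kappa_compact_gcantor_weakly_compact.
apply: kappa_compact_image (kappa_compact_closed_sub cA clC CA) fcont fC _.
by move=> x xC; exists (g x); [exact: gC|rewrite gK ?inE].
Qed.

End RegularCompactness.

(** * Singletons, and the cycle of implications between the three conditions *)

Lemma kappa_compact_set1 {d} {K : bOrderType d} (x : gbaire K) :
  ~ countable [set: K] -> kappa_compact [set x].
Proof.
move=> nc F Fop Fcov; have [U FU Ux] := Fcov x erefl.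
have ncU : ~ ([set: K] #<= [set U]) by apply: countable_not_le nc; exact: countable1.
exists [set U]; split; [by move=> _ ->|split=> //|by move=> _ ->; exists U].
by apply: (card_le_of_inj (fun=> \bot)) => // V W; rewrite !inE => -> ->.
Qed.

Theorem corollary2p8 (d : Order.disp_t) (K : bOrderType d)
    (K_cardinal : is_initial_ordinal K)
    (K_uncountable : ~ countable [set: K])
    (K_power : [set: lt_kappa_seq K] #= [set: K])
    (K_not_weakly_compact : ~ weakly_compact K)
    (closed_psp : forall C : set (gbaire K), closed C -> kappa_psp C)
    (A : set (gbaire K)) :
  (K_kappa A <-> exists B : set (gbaire K), K_kappa B /\ A `<=` B) /\
  ((exists B : set (gbaire K), K_kappa B /\ A `<=` B) <-> A #<= [set: K]).
Proof.
have [power_le _] : [set: lt_kappa_seq K] #<= [set: K] /\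
    [set: K] #<= [set: lt_kappa_seq K] by apply/andP; rewrite -card_eq_le.
have ab : K_kappa A -> exists B : set (gbaire K), K_kappa B /\ A `<=` B.
  by move=> KA; exists A; split.
have bc : (exists B : set (gbaire K), K_kappa B /\ A `<=` B) -> A #<= [set: K].
  move=> [_ [[F [FK Fcomp ->]] AF]]; apply: card_le_trans (subset_card_le AF) _.
  apply: card_bigcup_le => // B /Fcomp; exact: kappa_compact_card_le.
have ca : A #<= [set: K] -> K_kappa A.
  move=> AK; exists (set1 @` A); split.
  - exact: card_le_trans (card_image_le set1 A) AK.
  - by move=> _ [x _ <-]; exact: kappa_compact_set1.
  - by apply/seteqP; split=> [x Ax|x [_ [y Ay <-] ->]//]; exists [set x] => //; exists x.
by split; split=> //; [move=> /bc/ca|move=> /ca/ab].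
Qed.
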